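(* Let $a,b,n$ be positive integers with $a\leqslant b$ and $a\leqslant \lfloor n/2\rfloor$, and put $$f(a,b)=\left\lfloor\frac{an-1}{a+b}\right\rfloor\left(n-\left\lfloor\frac{an-1}{a+b}\right\rfloor\right).$$ Let $G$ be an $n$-vertex bipartite graph containing no $[a,b]$-factor. (i) If $f(a,b)>\lfloor n/2\rfloor(\lceil n/2\rceil-1)+a-1$, then $e(G)\leqslant f(a,b)$ with equality if and only if $G\cong K_{\lfloor\frac{an-1}{a+b}\rfloor,\,n-\lfloor\frac{an-1}{a+b}\rfloor}$. (ii) If $n$ is even and $f(a,b)=\frac n2(\frac n2-1)+a-1$, then $e(G)\leqslant f(a,b)$ with equality if and only if $G\in\{K_{\lfloor\frac{an-1}{a+b}\rfloor,\,n-\lfloor\frac{an-1}{a+b}\rfloor},\ D(a-1,\frac n2-a;\frac n2,1),\ D(a-1,\frac n2-a+1;\frac n2-1,1)\}$. (iii) If $n$ is odd and $f(a,b)=(\frac{n-1}{2})^2+a-1$, then $e(G)\leqslant f(a,b)$ with equality if and only if $G\in\{K_{\lfloor\frac{an-1}{a+b}\rfloor,\,n-\lfloor\frac{an-1}{a+b}\rfloor},\ D(a-1,\frac{n+1}{2}-a;\frac{n-1}{2},1)\}$. (iv) If $n$ is even and $f(a,b)<\frac n2(\frac n2-1)+a-1$, then $e(G)\leqslant \frac n2(\frac n2-1)+a-1$ with equality if and only if $G\in\{D(a-1,\frac n2-a;\frac n2,1),\ D(a-1,\frac n2-a+1;\frac n2-1,1)\}$. (v) If $n$ is odd and $f(a,b)<(\frac{n-1}{2})^2+a-1$,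 then $e(G)\leqslant (\frac{n-1}{2})^2+a-1$ with equality if and only if $G\cong D(a-1,\frac{n+1}{2}-a;\frac{n-1}{2},1)$.
   Context: For positive integers $a\leqslant b$, an $[a,b]$-factor of a graph $G$ is a spanning subgraph $F$ with $a\leqslant d_F(v)\leqslant b$ for all $v$. For nonnegative integers $p_1,p_2,q_1,q_2$, $D(p_1,p_2;q_1,q_2)$ denotes the bipartite graph with parts $X=X_1\cup X_2$, $Y=Y_1\cup Y_2$ (disjoint), $|X_i|=p_i$, $|Y_i|=q_i$, in which every vertex of $X_1$ is adjacent to every vertex of $Y_1\cup Y_2$, every vertex of $X_2$ is adjacent to every vertex of $Y_1$, and there are no other edges. *)

(* Defs.v *)
From mathcomp Require Import all_boot.

Set Implicit Arguments.
Unset Strict Implicit.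
Unset Printing Implicit Defensive.

Record sgraph (V : finType) := SGraph {
  adj :> rel V;
  adj_sym : symmetric adj;
  adj_irr : irreflexive adj
}.

Definition edges (V : finType) (G : sgraph V) : {set {set V}} :=
  [set [set x; y] | x in V, y in V & G x y].

Definition degree (V : finType) (G : sgraph V) (v : V) : nat :=
  #|[set w | G v w]|.

Definition bipartite (V : finType) (G : sgraph V) : Prop :=
  exists X : {set V}, forall x y : V, G x y -> (x \in X) != (y \in X).

(* A spanning subgraph of G is a graph on the same vertex type whose adjacency
   relation is contained in that of G. *)
Definition is_factor (V : finType) (a b : nat) (G F : sgraph V) : Prop :=
  (forall x y : V, F x y -> G x y) /\ (forall v : V, a <= degree F v <= b).

Definition has_factor (V : finType) (a b : nat) (G : sgraph V) : Prop :=
  exists F : sgraph V, is_factor a b G F.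

Definition graph_iso (V W : finType) (G : sgraph V) (H : sgraph W) : Prop :=
  exists2 h : V -> W, bijective h & forall x y : V, H (h x) (h y) = G x y.

Section BipGraph.
Variables (A B : finType) (R : A -> B -> bool).

Definition bip_adj : rel (A + B)%type := fun u v =>
  match u, v with
  | inl x, inr y => R x y
  | inr y, inl x => R x y
  | _, _ => false
  end.

Lemma bip_adj_sym : symmetric bip_adj.
Proof. by case=> x [] y. Qed.

Lemma bip_adj_irr : irreflexive bip_adj.
Proof. by case. Qed.

Definition bip_graph : sgraph (A + B)%type := SGraph bip_adj_sym bip_adj_irr.
End BipGraph.

Definition Kbip (p q : nat) : sgraph ('I_p + 'I_q)%type :=
  bip_graph (fun _ _ => true).

(* X_1 = 'I_p1, X_2 = 'I_p2, Y_1 = 'I_q1, Y_2 = 'I_q2: among the pairs in X * Y,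
   exactly those in X_2 * Y_2 are non-adjacent. *)
Definition Dgraph (p1 p2 q1 q2 : nat) :
    sgraph (('I_p1 + 'I_p2) + ('I_q1 + 'I_q2))%type :=
  bip_graph (fun (x : 'I_p1 + 'I_p2) (y : 'I_q1 + 'I_q2) =>
    match x, y with inr _, inr _ => false | _, _ => true end).

Definition kab (a b n : nat) : nat := (a * n - 1) %/ (a + b).

Definition fab (a b n : nat) : nat := kab a b n * (n - kab a b n).

(* Main.v *)
(** If a bipartite graph with parts X and Y has no [a,b]-factor, take a subgraph
    with maximum degree at most b and minimum total deficiency.  The vertices
    reachable from a deficient vertex by alternating paths give (up to exchanging
    X and Y) S in X and T in Y with b|S| + e(T, X \ S) < a|T|.

    Write p = |X|, q = |Y|.  If p or q is at most k = floor((an-1)/(a+b)), then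
    e(G) <= pq <= k(n-k).  If some vertex, say in Y, has degree < a, then
    e(G) <= p(q-1) + a-1, which is maximal for p and q-1 as equal as possible.
    Otherwise the barrier (S,T) forces e(G) <= p(q-1) + a-1 as well; equality is
    then possible only for a = b, and there k(n-k) is strictly larger. *)

Require Import Defs.
From mathcomp Require Import all_boot.
From mathcomp Require Import zify.

Set Implicit Arguments.
Unset Strict Implicit.
Unset Printing Implicit Defensive.

(** * Toggling a single edge *)

Section Toggle.
Variable V : finType.
Implicit Types (F G : sgraph V) (u v w : V).

Lemma degreeE F v : degree F v = \sum_w F v w.
Proof.
rewrite /degree -sum1_card big_mkcond /=; apply: eq_bigr => w _.
by rewrite inE; case: (F v w).
Qed.

Definition is_pair u v : rel V :=
  fun x y => ((x == u) && (y == v)) || ((x == v) && (y == u)).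

Lemma is_pair_sym u v : symmetric (is_pair u v).
Proof. by move=> x y; rewrite /is_pair orbC ![(y == _) && _]andbC. Qed.

Lemma is_pair_irr u v : u != v -> irreflexive (is_pair u v).
Proof.
move=> /negP uv x; apply/negP; rewrite /is_pair => /orP[] /andP[/eqP e1 /eqP e2];
  by apply: uv; rewrite -e1 -e2.
Qed.

Lemma sum_is_pair u v w : u != v ->
  \sum_x (is_pair u v w x : nat) = (w == u) + (w == v).
Proof.
move=> uv.
have eqd (z : V) : \sum_x (x == z : nat) = 1.
  by rewrite (bigD1 z) //= eqxx big1 ?addn0 // => x /negbTE ->.
rewrite /is_pair; case: (eqVneq w u) => [->|wu].
  by rewrite (negbTE uv) /= -[RHS](eqd v); apply: eq_bigr => x _; rewrite orbF.
case: (eqVneq w v) => _; last by rewrite big1.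
by rewrite -[RHS](eqd u); apply: eq_bigr.
Qed.

(** Losses stand on the left and gains on the right, which avoids truncated subtraction; one of the
    two products always vanishes. *)
Lemma toggle_edge F u v : u != v -> exists2 F' : sgraph V,
  (forall x y, F' x y = F x y (+) is_pair u v x y) &
  forall w, degree F' w + F u v * ((w == u) + (w == v)) =
            degree F w + ~~ F u v * ((w == u) + (w == v)).
Proof.
move=> uv.
have sym : symmetric (fun x y => F x y (+) is_pair u v x y).
  by move=> x y; rewrite adj_sym is_pair_sym.
have irr : irreflexive (fun x y => F x y (+) is_pair u v x y).
  by move=> x; rewrite adj_irr is_pair_irr.
exists (SGraph sym irr) => // w; rewrite !degreeE -(sum_is_pair w uv) /=.
rewrite !big_distrr -!big_split /=; apply: eq_bigr => x _.
have: is_pair u v w x -> F w x = F u v.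
  by move=> /orP[] /andP[/eqP -> /eqP ->] //; rewrite adj_sym.
by case: (is_pair u v w x) => [->|_]; case: (F u v); case: (F w x).
Qed.

End Toggle.

(** * Alternating paths, deficiency and barriers *)

Section Augment.
Variables (V : finType) (G : sgraph V) (X : {set V}).
Hypothesis bipX : forall x y, G x y -> (x \in X) != (y \in X).
Implicit Types (F : sgraph V) (u v w : V).

Definition subgraph F := forall x y, F x y -> G x y.

(* The residual digraph: edges of F are traversed out of X, the other edges of
   G into X, so a walk leaving ~X alternately adds and deletes edges. *)
Definition residual F : rel V := fun u v => G u v && (F u v == (u \in X)).

(** Insertions and deletions alternate along a residual path, so toggling all its edges cancels out
    at interior vertices. Each end gains or loses one according to its side; for the empty path the
    two end terms cancel. *)
Lemma augment_path F u p : subgraph F -> path (residual F) u p ->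
  uniq (u :: p) -> exists2 F', subgraph F' &
  forall w, degree F' w + ((w == u) && (u \in X))
              + ((w == last u p) && (last u p \notin X)) =
            degree F w + ((w == u) && (u \notin X))
              + ((w == last u p) && (last u p \in X)).
Proof.
elim: p u F => [|v p IHp] u F sFG /=.
  by move=> _ _; exists F => // w; rewrite addnAC.
case/andP=> /andP[Guv /eqP Fuv] pth /andP[u_notin Uvp].
have uv : u != v by apply: contraNneq u_notin => ->; rewrite inE eqxx.
have [F1 F1E degF1] := toggle_edge F uv.
have sF1 : subgraph F1.
  move=> x y; rewrite F1E; case: (boolP (is_pair u v x y)) => [|_].
    by move=> /orP[] /andP[/eqP -> /eqP ->] // _; rewrite adj_sym.
  by rewrite addbF; apply: sFG.
(* The rest of the path avoids [u], so toggling [uv] does not affect its arcs. *)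
have pth1 : path (residual F1) v p.
  apply: (@sub_in_path _ (mem (v :: p)) _ _ _ _ _ (allss (v :: p))) pth.
  move=> x y xin yin; rewrite /residual F1E.
  have -> : is_pair u v x y = false; last by rewrite addbF.
  apply/negP => /orP[] /andP[/eqP e1 /eqP e2]; move: u_notin.
    by rewrite -e1 xin.
  by rewrite -e2 yin.
have [F' sF' degF'] := IHp v F1 sF1 pth1 Uvp.
exists F' => // w; have := degF' w; have := degF1 w; have := bipX Guv.
rewrite Fuv; case: (u \in X) (v \in X) => [] [] //= _;
  case: (w == u); case: (w == v); lia.
Qed.

(** A certificate that no [a,b]-factor exists: the vertices of [T] need at least [a * #|T|] factor
    edges, but [S] can absorb at most [b * #|S|] of them and the others must be edges of [G] between
    [T] and [X :\: S]. *)
Definition barrier (a b : nat) := exists S T : {set V},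
  [/\ S \subset X, T \subset ~: X &
      b * #|S| + \sum_(y in T) \sum_(x in X :\: S) G y x < a * #|T|].

Definition deficiency a F := \sum_v (a - degree F v).

(** The [minn] allows a vertex to lose surplus degree as long as it keeps [a]. *)
Lemma deficiency_lt a F F' y : degree F y < a -> degree F y < degree F' y ->
  (forall w, minn a (degree F w) <= degree F' w) ->
  deficiency a F' < deficiency a F.
Proof.
move=> ya yy' le; rewrite /deficiency (bigD1 y) //= [X in _ < X](bigD1 y) //=.
rewrite -addSn leq_add //; first by lia.
by apply: leq_sum => w _; have := le w; lia.
Qed.

(* If no residual path from y improves F, the set of vertices reachable from y
   is saturated and yields the barrier. *)
Lemma augment_or_barrier a b F y : a <= b -> subgraph F ->
  (forall v, degree F v <= b) -> y \notin X -> degree F y < a ->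
  (exists2 F', subgraph F' & (forall v, degree F' v <= b) /\
     deficiency a F' < deficiency a F) \/ barrier a b.
Proof.
move=> leab sF degF yX ya; set r := residual F.
pose R := [set v | connect r y v].
have yR : y \in R by rewrite inE connect0.
(* Augmenting along a simple path from [y] to [v] adds one to the degree of [y], and adds one at [v]
   inside [X] or removes one at [v] outside [X]. *)
have aug v : v \in R -> exists2 F', subgraph F' &
  forall w, degree F' w + ((w == v) && (v \notin X)) =
            degree F w + (w == y) + ((w == v) && (v \in X)).
  rewrite inE => /connectP[p0 pth0 ->]; case/shortenP: pth0 => p pth Up _.
  have [F' sF' dF'] := augment_path sF pth Up.
  by exists F' => // w; have := dF' w; rewrite (negbTE yX) andbF andbT addn0.
(* A reachable vertex of [X] with spare capacity can take one more edge. *)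
case: (boolP [exists v in R, (v \in X) && (degree F v < b)]) => [|/existsPn hX].
  case/existsP=> x /and3P[xR xX xb]; left; have [F' sF' dF'] := aug x xR.
  have xy : y != x by apply: contraNneq yX => ->.
  exists F' => //; split=> [w|].
    have := dF' w; have := degF w; rewrite xX /=.
    case: (eqVneq w y) => [->|_]; first by rewrite (negbTE xy); lia.
    by case: (eqVneq w x) => [->|_] /=; lia.
  apply: (@deficiency_lt _ _ _ y) => // [|w].
    by have := dF' y; rewrite xX eqxx /=; lia.
  by have := dF' w; rewrite xX /=; lia.
(* A reachable vertex outside [X] with degree above [a] can give up one edge. *)
case: (boolP [exists v in R, (v \notin X) && (a < degree F v)]) => [|/existsPn hY].
  case/existsP=> z /and3P[zR zX za]; left; have [F' sF' dF'] := aug z zR.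
  have zy : y != z by apply: contraTneq za => <-; lia.
  exists F' => //; split=> [w|].
    have := dF' w; have := degF w; rewrite zX (negbTE zX) andbF andbT.
    by case: (eqVneq w y) => [->|_]; lia.
  apply: (@deficiency_lt _ _ _ y) => // [|w].
    by have := dF' y; rewrite zX (negbTE zX) andbF eqxx (negbTE zy) /=; lia.
  have := dF' w; rewrite zX (negbTE zX) andbF andbT.
  by case: (eqVneq w z) => [->|_]; lia.
right; exists (R :&: X), (R :&: ~: X); split; rewrite ?subsetIr //.
have step u v : u \in R -> r u v -> v \in R.
  by rewrite !inE => yu uv; apply: connect_trans yu (connect1 uv).
(* Reachable vertices of [X] are saturated, and their [F]-edges are residual arcs, hence end at
   reachable vertices. *)
have degS : b * #|R :&: X| =
    \sum_(x in R :&: X) \sum_(z in R :&: ~: X) F x z.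
  rewrite mulnC -sum_nat_const; apply: eq_bigr => x /setIP[xR xX].
  have := hX x; rewrite xR xX /= -leqNgt => bx.
  have -> : b = degree F x by apply/eqP; rewrite eqn_leq bx degF.
  rewrite degreeE [RHS]big_mkcond /=; apply: eq_bigr => z _.
  case: (boolP (F x z)) => [Fxz|_]; last by case: ifP.
  rewrite inE (step x) //=; last by rewrite /r /residual sF // Fxz xX.
  by have := bipX (sF _ _ Fxz); rewrite xX inE; case: (z \in X).
rewrite degS exchange_big -big_split /= mulnC -sum_nat_const.
(* An edge of [G] from a reachable [z] to an unreachable vertex of [X] must belong to [F], otherwise
   it would be a residual arc. *)
have bnd z : z \in R :&: ~: X -> \sum_(x in R :&: X) F x z +
    \sum_(x in X :\: (R :&: X)) G z x <= degree F z.
  case/setIP=> zR; rewrite inE => zX.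
  rewrite degreeE [X in _ <= X](bigID (mem (R :&: X))) /= leq_add //.
    by apply: leq_sum => x _; rewrite adj_sym.
  rewrite [X in X <= _]big_mkcond [X in _ <= X]big_mkcond /=; apply: leq_sum => x _.
  rewrite !inE; case: (boolP (x \in X)) => xX; last by rewrite !andbF.
  rewrite !andbT; case: (boolP (connect r y x)) => //= nyx.
  case: (boolP (G z x)) => // Gzx; case: (boolP (F z x)) => // Fzx.
  case/negP: nyx; have := step z x zR; rewrite [x \in R]inE; apply.
  by rewrite /r /residual Gzx (negbTE Fzx) (negbTE zX).
(* All of [T] has degree at most [a], and the deficient vertex [y] makes the inequality strict. *)
have yT : y \in R :&: ~: X by rewrite !inE connect0 yX.
rewrite [X in X < _](bigD1 y) //= [X in _ < X](bigD1 y) //=.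
rewrite -addSn leq_add //; first by apply: leq_ltn_trans (bnd y yT) ya.
apply: leq_sum => z /andP[zT _]; apply: leq_trans (bnd z zT) _.
by case/setIP: zT => zR; rewrite inE => zX; have := hY z; rewrite zR zX /= -leqNgt.
Qed.

End Augment.

(** Starting from the empty subgraph, augment while some vertex is deficient; the deficiency drops
    each time. The side of the deficient vertex decides which part plays the role of [X]. *)
Theorem bipartite_factor_or_barrier (V : finType) (G : sgraph V) (X : {set V}) a b :
  (forall x y, G x y -> (x \in X) != (y \in X)) -> a <= b ->
  [\/ has_factor a b G, barrier G X a b | barrier G (~: X) a b].
Proof.
move=> bipX leab.
have bipC x y : G x y -> (x \in ~: X) != (y \in ~: X).
  by move/bipX; rewrite !inE; case: (x \in X); case: (y \in X).
suff IH d (F : sgraph V) : subgraph G F -> (forall v, degree F v <= b) ->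
    deficiency a F < d ->
    [\/ has_factor a b G, barrier G X a b | barrier G (~: X) a b].
  have s0 : symmetric (fun x y : V => false) by [].
  have i0 : irreflexive (fun x y : V => false) by [].
  apply: (IH _ (SGraph s0 i0) _ _ (ltnSn _)) => // v.
  by rewrite degreeE big1.
elim: d F => // d IH F sF degF ltd.
case: (boolP [forall v, a <= degree F v]) => [/forallP aF|/forallPn[y]].
  by apply: Or31; exists F; split=> // v; rewrite aF degF.
rewrite -ltnNge => ya.
have next Z : (exists2 F', subgraph G F' & (forall v, degree F' v <= b) /\
     deficiency a F' < deficiency a F) \/ barrier G Z a b ->
   [\/ has_factor a b G, barrier G X a b | barrier G (~: X) a b] \/ barrier G Z a b.
  case=> [[F' sF' [dF' lt']]|]; last by right.
  by left; apply: (IH F') => //; apply: leq_trans lt' _.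
case: (boolP (y \in X)) => yX.
  have yC : y \notin ~: X by rewrite inE negbK.
  case: (next (~: X)) => //; last by move=> ?; apply: Or33.
  exact: augment_or_barrier ya.
case: (next X) => //; last by move=> ?; apply: Or32.
exact: augment_or_barrier ya.
Qed.

(** * Counting edges across a bipartition *)

Section EdgeCount.
Variables (V : finType) (G : sgraph V) (X : {set V}).
Hypothesis bipX : forall x y, G x y -> (x \in X) != (y \in X).

Lemma card_edges : #|edges G| = \sum_(x in X) \sum_(y in ~: X) G x y.
Proof.
pose E := [set p : V * V | (p.1 \in X) && G p.1 p.2].
have notX x y : x \in X -> G x y -> y \notin X.
  by move=> xX /bipX; rewrite xX; case: (y \in X).
(* Each edge is represented by its ordered pair starting in [X], which makes the map to unordered
   pairs injective. *)
have -> : edges G = (fun p => [set p.1; p.2]) @: E.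
  apply/setP=> e; apply/imset2P/imsetP.
    case=> x y _; rewrite inE /= => Gxy ->.
    case: (boolP (x \in X)) => xX; first by exists (x, y); rewrite ?inE /= ?xX.
    exists (y, x); last by rewrite /= setUC.
    rewrite inE /= adj_sym Gxy andbT.
    by have := bipX Gxy; rewrite (negbTE xX); case: (y \in X).
  case=> [[x y]]; rewrite inE /= => /andP[_ Gxy] ->.
  by exists x y; rewrite ?inE.
rewrite card_in_imset => [|[x y] [x' y']]; last first.
  rewrite !inE /= => /andP[xX Gxy] /andP[xX' Gxy'] eqe.
  have yX := notX _ _ xX Gxy; have yX' := notX _ _ xX' Gxy'.
  have /set2P[->|e] : x \in [set x'; y'] by rewrite -eqe set21.
    have /set2P[e|->] // : y \in [set x'; y'] by rewrite -eqe set22.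
    by rewrite e xX' in yX.
  by rewrite -e xX in yX'.
rewrite pair_big /= -sum1_card [LHS]big_mkcond [RHS]big_mkcond /=.
apply: eq_bigr => [[x y]] _ /=; rewrite !inE /=.
case: (boolP (x \in X)) => //= xX; case: (boolP (G x y)) => [Gxy|_]; last by case: ifP.
by rewrite (notX x y).
Qed.

Lemma card_edges_compl :
  #|edges G| + \sum_(x in X) \sum_(y in ~: X) ~~ G x y = #|X| * #|~: X|.
Proof.
rewrite card_edges -big_split /= -sum_nat_const; apply: eq_bigr => x _.
rewrite -big_split /= -sum1_card; apply: eq_bigr => y _.
by case: (G x y).
Qed.

Lemma degree_part y : y \in ~: X -> degree G y = \sum_(x in X) G y x.
Proof.
rewrite inE degreeE => yX; rewrite [RHS]big_mkcond; apply: eq_bigr => x _.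
case: ifP => // xX; apply/eqP; rewrite eqb0; apply/negP => /bipX.
by rewrite xX (negbTE yX).
Qed.

Lemma card_edges_degree : #|edges G| = \sum_(y in ~: X) degree G y.
Proof.
rewrite card_edges exchange_big /=; apply: eq_bigr => y yX.
by rewrite degree_part //; apply: eq_bigr => x _; rewrite adj_sym.
Qed.

Lemma degree_le y : y \in ~: X -> degree G y <= #|X|.
Proof.
by move=> /degree_part ->; rewrite -sum1_card; apply: leq_sum => x _; case: (G y x).
Qed.

Lemma card_edges_complete : #|edges G| = #|X| * #|~: X| ->
  forall x y, x \in X -> y \in ~: X -> G x y.
Proof.
move=> eE x y xX yX; have /eqP := card_edges_compl; rewrite eE -{2}[_ * _]addn0.
rewrite eqn_add2l sum_nat_eq0 => /forall_inP/(_ x xX).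
by rewrite sum_nat_eq0 => /forall_inP/(_ y yX); rewrite eqb0 negbK.
Qed.

End EdgeCount.

(** * Isomorphisms from vertex colourings *)

(** Each vertex goes to the vertex with the same rank in the enumeration of the corresponding colour
    class. *)
Lemma color_bijection (V W : finType) (C : eqType) (c : V -> C) (c' : W -> C) :
  (forall i, #|[set v | c v == i]| = #|[set w | c' w == i]|) ->
  exists2 h : V -> W, bijective h & forall v, c' (h v) = c v.
Proof.
move=> eqc; pose e i := enum [set v | c v == i]; pose e' i := enum [set w | c' w == i].
have sz i : size (e i) = size (e' i) by rewrite -!cardE.
have ve v : v \in e (c v) by rewrite mem_enum inE.
have nz v : 0 < size (e' (c v)) by rewrite -sz; case: (e _) (ve v).
(* This only provides a default for [nth], which is never reached since the index is in range. *)
have inhW (v : V) : exists _ : W, true by case: (e' _) (nz v) => // w _ _; exists w.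
pose h v := nth (xchoose (inhW v)) (e' (c v)) (index v (e (c v))).
have idx v : index v (e (c v)) < size (e' (c v)) by rewrite -sz index_mem.
have hc v : c' (h v) = c v.
  have := mem_nth (xchoose (inhW v)) (idx v).
  by rewrite -/(h v) mem_enum inE => /eqP.
have e'e w : w \in e' (c' w) by rewrite mem_enum inE.
have nz' w : 0 < size (e (c' w)) by rewrite sz; case: (e' _) (e'e w).
have inhV (w : W) : exists _ : V, true by case: (e _) (nz' w) => // v _ _; exists v.
pose g w := nth (xchoose (inhV w)) (e (c' w)) (index w (e' (c' w))).
have idx' w : index w (e' (c' w)) < size (e (c' w)) by rewrite sz index_mem.
have gc w : c (g w) = c' w.
  have := mem_nth (xchoose (inhV w)) (idx' w).
  by rewrite -/(g w) mem_enum inE => /eqP.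
exists h => //; exists g => [v|w].
  by rewrite /g hc {1}/h index_uniq ?enum_uniq // nth_index.
by rewrite /h gc {1}/g index_uniq ?enum_uniq // nth_index.
Qed.

Lemma iso_of_coloring (V W : finType) (C : eqType) (G : sgraph V) (H : sgraph W)
    (phi : C -> C -> bool) (c : V -> C) (c' : W -> C) :
  (forall x y, G x y = phi (c x) (c y)) -> (forall x y, H x y = phi (c' x) (c' y)) ->
  (forall i, #|[set v | c v == i]| = #|[set w | c' w == i]|) -> graph_iso G H.
Proof.
move=> GE HE /color_bijection[h bij_h hc].
by exists h => // x y; rewrite HE !hc GE.
Qed.

Lemma iso_card_edges (V W : finType) (G : sgraph V) (H : sgraph W) :
  graph_iso G H -> #|edges G| = #|edges H|.
Proof.
case=> h [g hK gK] hE; have inj_h := can_inj hK.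
rewrite -(card_imset _ (imset_inj inj_h)); apply: eq_card => e.
apply/imsetP/imset2P => [[e0 /imset2P[x y _ Gxy ->] ->]|[x y _ Hxy ->]].
  by exists (h x) (h y); rewrite // ?imsetU1 ?imset_set1 // inE /= hE; move: Gxy; rewrite inE.
exists [set g x; g y]; last by rewrite imsetU1 imset_set1 !gK.
by apply/imset2P; exists (g x) (g y); rewrite // inE /= -hE !gK; move: Hxy; rewrite inE.
Qed.

(** * Edge counts of the concrete graphs *)

Section BipCount.
Variables (A B : finType) (R : A -> B -> bool).

Lemma card_edges_bip_graph :
  #|edges (bip_graph R)| = \sum_x \sum_y R x y.
Proof.
pose X : {set A + B} := [set u | if u is inl _ then true else false].
rewrite (@card_edges _ _ X); last by case=> x [] y //; rewrite !inE.
rewrite big_mkcond big_sumType /= [X in _ + X]big1 ?addn0; last first.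
  by move=> y _; rewrite inE.
apply: eq_bigr => x _; rewrite inE big_mkcond big_sumType /= big1 ?add0n.
  by apply: eq_bigr => y _; rewrite !inE.
by move=> y _; rewrite !inE.
Qed.
End BipCount.

Lemma card_edges_Kbip p q : #|edges (Kbip p q)| = p * q.
Proof.
rewrite card_edges_bip_graph.
under eq_bigr => x _ do rewrite sum_nat_const card_ord muln1.
by rewrite sum_nat_const card_ord.
Qed.

Lemma card_edges_Dgraph p1 p2 q1 q2 :
  #|edges (Dgraph p1 p2 q1 q2)| = p1 * (q1 + q2) + p2 * q1.
Proof.
rewrite card_edges_bip_graph big_sumType /=.
under eq_bigr => x _ do rewrite big_sumType /= !sum_nat_const !card_ord !muln1.
under [X in _ + X]eq_bigr => x _ do
  rewrite big_sumType /= !sum_nat_const !card_ord muln1 muln0 addn0.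
by rewrite !sum_nat_const !card_ord.
Qed.

Lemma card_set_sum (A B : finType) (P : pred (A + B)) :
  #|[set u | P u]| = #|[set x | P (inl x)]| + #|[set y | P (inr y)]|.
Proof.
rewrite -!sum1_card big_mkcond big_sumType /=; congr (_ + _);
  by rewrite [RHS]big_mkcond; apply: eq_bigr => x _; rewrite !inE.
Qed.

Lemma card_set_const (A : finType) (b : bool) : #|[set x : A | b]| = b * #|A|.
Proof.
case: b; first by rewrite mul1n -cardsT; apply: eq_card => x; rewrite !inE.
by rewrite mul0n; apply/eqP; rewrite cards_eq0; apply/eqP/setP=> x; rewrite !inE.
Qed.

(** * Recognising the extremal graphs *)

Section Extremal.
Variables (V : finType) (G : sgraph V) (X : {set V}).
Hypothesis bipX : forall x y, G x y -> (x \in X) != (y \in X).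

Lemma iso_Kbip : #|edges G| = #|X| * #|~: X| -> graph_iso G (Kbip #|X| #|~: X|).
Proof.
move=> /(card_edges_complete bipX) cpl.
pose c' (u : 'I_#|X| + 'I_#|~: X|) := if u is inl _ then true else false.
apply: (@iso_of_coloring _ _ _ _ _ (fun i j => i != j) (mem X) c') => [x y||].
- apply/idP/idP; first exact: bipX.
  have cplx := cpl x y; have cply := cpl y x; move: cplx cply; rewrite !inE /=.
  case: (x \in X); case: (y \in X) => //= Gxy Gyx _; first exact: Gxy.
  by rewrite adj_sym Gyx.
- by case=> x [] y.
move=> i; rewrite card_set_sum /= !card_set_const !card_ord.
case: i; rewrite mul0n mul1n ?addn0 ?add0n; apply: eq_card => x; rewrite !inE //=;
  by case: (x \in X).
Qed.

Lemma sum_part_but1 y : y \in ~: X ->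
  #|X| * (#|~: X| - 1) = \sum_(z in ~: X | z != y) #|X|.
Proof.
move=> yX; rewrite sum_nat_const mulnC subn1 (cardsD1 y (~: X)) yX /=; congr (_ * _).
by apply: eq_card => z; rewrite [RHS]unfold_in /= !inE andbC.
Qed.

(* Deleting a vertex y of low degree leaves a bipartite graph with parts of
   sizes |X| and |~: X| - 1. *)
Lemma card_edges_low_degree y : y \in ~: X ->
  #|edges G| <= #|X| * (#|~: X| - 1) + degree G y.
Proof.
move=> yX; rewrite (card_edges_degree bipX) (bigD1 y) //= addnC leq_add2r.
by rewrite (sum_part_but1 yX); apply: leq_sum => z /andP[zX _]; apply: degree_le.
Qed.

(** Equality in the deletion bound makes every vertex outside [X] other than [y] adjacent to all of
    [X], so only the neighbourhood of [y] remains free; it becomes the part X_1. *)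
Lemma iso_Dgraph y : y \in ~: X ->
  #|edges G| = #|X| * (#|~: X| - 1) + degree G y ->
  graph_iso G (Dgraph (degree G y) (#|X| - degree G y) (#|~: X| - 1) 1).
Proof.
move=> yX eE; have yX' : y \notin X by move: yX; rewrite inE.
have cpl x z : x \in X -> z \in ~: X -> z != y -> G x z.
  move=> xX zX zy; apply/negPn/negP => nG.
  move: eE; rewrite (card_edges_degree bipX) (bigD1 y) //= addnC => /addIn.
  apply/eqP; rewrite neq_ltn; apply/orP; left.
  rewrite (sum_part_but1 yX) (bigD1 z) ?zX //= [X in _ < X](bigD1 z) ?zX //= -addSn leq_add //; last first.
    by apply: leq_sum => t /andP[/andP[tX _] _]; apply: degree_le.
  rewrite (degree_part bipX) // -sum1_card (bigD1 x) //= [X in _ < X](bigD1 x) //=.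
  rewrite adj_sym (negbTE nG) add0n add1n ltnS.
  by apply: leq_sum => t _; case: (G z t).
(* The first component is the side; the second marks X_2 (non-neighbours of [y]) and Y_2 ([y]
   itself). Vertices on opposite sides are adjacent unless both are marked. *)
pose c v := (v \in X, if v \in X then ~~ G y v else v == y).
pose phi (i j : bool * bool) := (i.1 != j.1) && ~~ (i.2 && j.2).
pose c' (u : ('I_(degree G y) + 'I_(#|X| - degree G y)) + ('I_(#|~: X| - 1) + 'I_1)) :=
  match u with
  | inl x => (true, if x is inr _ then true else false)
  | inr x => (false, if x is inr _ then true else false)
  end.
have phiG x z : x \in X -> z \notin X -> G x z = ~~ (~~ G y x && (z == y)).
  move=> xX zX; case: (eqVneq z y) => [->|zy].
    by rewrite andbT negbK adj_sym.
  by rewrite andbF cpl // inE.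
apply: (@iso_of_coloring _ _ _ _ _ phi c c') => [x z||].
- rewrite /phi /c /=; case: (boolP (x \in X)) => xX; case: (boolP (z \in X)) => zX //=.
  + by apply/negP => /bipX; rewrite xX zX.
  + exact: phiG.
  + by rewrite adj_sym phiG // andbC.
  + by apply/negP => /bipX; rewrite (negbTE xX) (negbTE zX).
- by case=> [] [] x [] [] z.
have degX : #|[set x in X | G y x]| = degree G y.
  apply: eq_card => x; rewrite !inE andb_idl // => /bipX.
  by rewrite (negbTE yX'); case: (x \in X).
move=> [i1 i2]; rewrite !card_set_sum /= !card_set_const !card_ord !xpair_eqE.
case: i1; case: i2; rewrite /= ?mul0n ?mul1n ?addn0 ?add0n.
- rewrite -degX -(cardsID [set x | G y x] X) -setIdE addKn.
  by apply: eq_card => x; rewrite !inE /c xpair_eqE; case: (x \in X); case: (G y x).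
- rewrite -degX; apply: eq_card => x; rewrite !inE /c xpair_eqE.
  by case: (x \in X); case: (G y x).
- rewrite -(cards1 y); apply: eq_card => x; rewrite !inE /c xpair_eqE.
  case: (eqVneq x y) => [->|xy]; first by rewrite (negbTE yX').
  by case: (x \in X) => //=.
rewrite (cardsD1 y (~: X)) yX add1n subn1 /=; apply: eq_card => x.
by rewrite !inE /c xpair_eqE; case: (x \in X); rewrite ?andbF ?andbT //=.
Qed.

End Extremal.

(* The number of edges of the extremal graphs [Dgraph]; for odd [n = 2m+1] it is
   [m ^ 2 + a - 1]. *)
Definition bal a n := n %/ 2 * (uphalf n - 1) + a - 1.

(** * Arithmetic of the bounds [bal] and [fab] *)

Lemma bal_evenE a n m : n = m.*2 -> bal a n = m * (m - 1) + a - 1.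
Proof. by move=> ->; rewrite /bal divn2 uphalf_double doubleK. Qed.

Lemma bal_oddE a n m : n = m.*2.+1 -> bal a n = m * m + a - 1.
Proof.
move=> ->; rewrite /bal; have -> : m.*2.+1 %/ 2 = m by lia.
have -> : uphalf m.*2.+1 = m.+1 by lia.
by rewrite subSS subn0.
Qed.

Lemma nat_parity n : exists m, n = m.*2 \/ n = m.*2.+1.
Proof. by exists n./2; lia. Qed.

(** The factors [p] and [q - 1] have a fixed sum, so their product is largest when they are
    balanced; [d] below measures the imbalance. *)
Lemma mul_le_bal a p q : 0 < a -> 0 < q ->
  p * (q - 1) + a - 1 <= bal a (p + q).
Proof.
move=> a0; case: q => // q _; have [m [e|e]] := nat_parity (p + q.+1).
  rewrite (bal_evenE a e); suff: p * q <= m * (m - 1) by lia.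
  case: m e => [|m] e; first by lia.
  rewrite !subn1 /=; have [d [pE|pE]] : exists d, p = m.+1 + d \/ p + d = m.
  - by case: (leqP m.+1 p) => h; [exists (p - m.+1) | exists (m - p)]; lia.
  - have : q + d = m by lia.
    by nia.
  have : q = m.+1 + d by lia.
  by nia.
rewrite (bal_oddE a e); suff: p * q <= m * m by lia.
have [d [pE|pE]] : exists d, p = m + d \/ p + d = m.
- by case: (leqP m p) => h; [exists (p - m) | exists (m - p)]; lia.
- have : q + d = m by lia.
  by nia.
have : q = m + d by lia.
by nia.
Qed.

(** For even [p + q] the factors [p] and [q - 1] differ by one in either direction, which accounts
    for the two extremal graphs [Dgraph]. *)
Lemma eq_bal a p q : 0 < a -> 0 < q -> p * (q - 1) + a - 1 = bal a (p + q) ->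
  if odd (p + q) then q = p.+1 else q = p \/ q = p.+2.
Proof.
move=> a0; case: q => // q _; have [m [e|e]] := nat_parity (p + q.+1).
  rewrite (bal_evenE a e) e odd_double subn1 /= => ee.
  have {}ee : p * q = m * (m - 1) by lia.
  case: m e ee => [|m] e; first by lia.
  rewrite !subn1 /=; have [d [pE|pE]] : exists d, p = m.+1 + d \/ p + d = m.
  - by case: (leqP m.+1 p) => h; [exists (p - m.+1) | exists (m - p)]; lia.
  - have : q + d = m by lia.
    by nia.
  have : q = m.+1 + d by lia.
  by nia.
rewrite (bal_oddE a e) e /= odd_double subn1 /= => ee.
have {}ee : p * q = m * m by lia.
have [d [pE|pE]] : exists d, p = m + d \/ p + d = m.
- by case: (leqP m p) => h; [exists (p - m) | exists (m - p)]; lia.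
- have : q + d = m by lia.
  by nia.
have : q = m + d by lia.
by nia.
Qed.

Lemma kab_small a b n p : 0 < a -> 0 < b -> 0 < n ->
  kab a b n < p -> a * n <= (a + b) * p.
Proof.
move=> a0 b0 n0; rewrite ltnNge leq_divRL; last by lia.
rewrite -ltnNge; nia.
Qed.

Lemma kab_lt_half a b n : 0 < a <= b -> 0 < n -> (kab a b n).*2 < n.
Proof.
move=> /andP[a0 ab] n0; have := leq_trunc_div (a * n - 1) (a + b).
rewrite -/(kab a b n); nia.
Qed.

(** For a fixed sum [n], the product p(n-p) increases strictly up to n/2, and [kab] lies below
    n/2. *)
Lemma fab_mono a b p q : 0 < a <= b -> 0 < p + q -> p <= kab a b (p + q) ->
  p * q <= fab a b (p + q) /\ (fab a b (p + q) <= p * q -> p = kab a b (p + q)).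
Proof.
move=> hab n0; have := kab_lt_half hab n0; rewrite /fab; move: (kab _ _ _) => k k2 pk.
have [d kE] : exists d, k = p + d by exists (k - p); lia.
have [r qE] : exists r, q = p + d.*2 + r.+1 by exists (q - p - d.*2).-1; lia.
by subst k q; split; nia.
Qed.

(** Here [s], [t] are the sizes of the barrier sets, [c] counts the edges between T and X \ S, and
    [e] counts all edges. Eliminating [c] gives e + t(p-s) + bs < pq + at. If p-s is at least a,
    then t > s suffices; otherwise the worst case is t = q. *)
Lemma barrier_bound a b p q s t c e : 0 < a <= b -> a <= p -> a * q <= b * p ->
  0 < s < p -> t <= q -> b * s + c < a * t -> e + t * (p - s) <= p * q + c ->
  a * q <= e -> e + p < p * q + a /\ (a < b -> (e + p).+1 < p * q + a).
Proof.
move=> /andP[a0 ab] ap aq /andP[s0 sp] tq bs ee eaq.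
case: (leqP a (p - s)) => psa.
  have [w pE] : exists w, p = s + a + w by exists (p - s - a); lia.
  have [v tE] : exists v, t = s + 1 + v by exists (t - s - 1); nia.
  subst p t; clear aq eaq tq ap sp psa.
  have : e + (s + 1 + v) * w + b * s + 1 <= (s + a + w) * q by nia.
  by split; nia.
have [r [rE r0 ra]] : exists r, [/\ p = s + r, 0 < r & r < a].
  by exists (p - s); split; lia.
have bnd : e + b * s + 1 + q * r <= p * q + q * a.
  subst p; nia.
have [u pE] : exists u, p = a + u by exists (p - a); lia.
case: (leqP b q) => bq.
  have [j qE] : exists j, q = b + j by exists (q - b); lia.
  have ju : a * j <= b * u by move: aq; rewrite qE pE; lia.
  (* Since b is at most q, the worst case is r = 1. *)
  have bnd' : e + b * u + 1 + j <= p * q + j * a.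
    have sr : b * s + q * r = b * p + j * r by rewrite rE qE; lia.
    have bp : b * p = b * a + b * u by rewrite pE mulnDr.
    have qa : q * a = b * a + j * a by rewrite qE mulnDl.
    have jr : j <= j * r by rewrite leq_pmulr.
    by lia.
  have key : u + j * a <= b * u + j.
    case: (leqP u j) => uj; first by lia.
    have [k uE] : exists k, u = j + k by exists (u - j); lia.
    have : j * a <= j * b by rewrite leq_mul2l ab orbT.
    have : k <= b * k by rewrite leq_pmull //; lia.
    by subst u; lia.
  split=> [|ab']; first by lia.
  have [lt|eq] : u + j * a < b * u + j \/ u + j * a = b * u + j by lia.
    by lia.
  have uj : u = j.
    case: (ltngtP u j) => // uj; first by lia.
    have [k uE] : exists k, u = j + k.+1 by exists (u - j).-1; lia.
    have : j * a <= j * b by rewrite leq_mul2l ab orbT.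
    have : k.+1 < b * k.+1 by rewrite ltn_Pmull //; lia.
    by subst u; lia.
  (* Equality in [key] would force p = a and q = b; then [eaq] demands all pq edges, contradicting
     [bnd']. *)
  have u0 : u = 0.
    case: (posnP u) => // u0; subst j; have : u * a < u * b by rewrite ltn_mul2l u0.
    by lia.
  by subst u j; lia.
have : e + b * u.+1 + 1 <= p * q + q.
  have [k aE] : exists k, a = r + k.+1 by exists (a - r).-1; lia.
  have [l bE] : exists l, b = q + l by exists (b - q); lia.
  have sE : s = k.+1 + u by lia.
  by subst a b s p; nia.
have : u <= b * u by rewrite leq_pmull //; lia.
by rewrite mulnS => bu h; split=> [|_]; lia.
Qed.

(** Equality forces a = b, and the two bounds on [kab] then give p = q and [kab] = p - 1. So [fab]
    is p^2 - 1, which exceeds [bal] when a < p; for a = p, minimum degree [a] would require p^2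
    edges. *)
Lemma barrier_bal a b p q e : 0 < a <= b -> a <= p -> 0 < q ->
  kab a b (p + q) < p -> kab a b (p + q) < q ->
  e + p < p * q + a -> (a < b -> (e + p).+1 < p * q + a) -> a * q <= e ->
  e <= bal a (p + q) /\ (e = bal a (p + q) -> bal a (p + q) < fab a b (p + q)).
Proof.
move=> hab ap q0 kp kq e1 e2 eaq; have /andP[a0 ab] := hab.
have mulq : p * q = p * (q - 1) + p by case: q q0 {kp kq e1 e2 eaq} => // q _; lia.
have le := mul_le_bal p a0 q0; split; first by lia.
move=> eE; case: (ltnP a b) => [/e2|ba]; first by lia.
have b0 : 0 < b by lia.
have n0 : 0 < p + q by lia.
have h1 := kab_small a0 b0 n0 kp; have h2 := kab_small a0 b0 n0 kq.
have {}ba : b = a by lia.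
subst b; have {h1 h2} pq : p = q by nia.
subst q; have kE : kab a a (p + p) = p - 1.
  have := kab_small (p := p - 1) a0 a0 n0; move: kp; set k := kab _ _ _.
  by move=> kp; case: (ltnP k (p - 1)) => [_ /(_ isT)|]; nia.
by rewrite /fab kE; have := bal_evenE a (addnn p); nia.
Qed.

(** * The three cases: small part, low degree, barrier *)

Section ExtremalCases.
Variables (V : finType) (G : sgraph V) (X : {set V}) (a b : nat).
Hypothesis bipX : forall x y, G x y -> (x \in X) != (y \in X).

Let sizes : #|X| + #|~: X| = #|V|.
Proof. exact: cardsC. Qed.

Lemma card_edges_le : #|edges G| <= #|X| * #|~: X|.
Proof. by rewrite -(card_edges_compl bipX) leq_addr. Qed.

Lemma low_degree_case y : a <= #|V| %/ 2 -> y \in ~: X -> degree G y < a ->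
  #|edges G| <= bal a #|V| /\
  (#|edges G| = bal a #|V| ->
   if odd #|V| then
     graph_iso G (Dgraph (a - 1) ((#|V| + 1) %/ 2 - a) ((#|V| - 1) %/ 2) 1)
   else graph_iso G (Dgraph (a - 1) (#|V| %/ 2 - a) (#|V| %/ 2) 1) \/
     graph_iso G (Dgraph (a - 1) (#|V| %/ 2 - a + 1) (#|V| %/ 2 - 1) 1)).
Proof.
move=> an yX ya; have a0 : 0 < a by lia.
have q0 : 0 < #|~: X| by apply/card_gt0P; exists y.
have leE := card_edges_low_degree bipX yX.
have leB := mul_le_bal #|X| a0 q0; have eqB := @eq_bal a #|X| _ a0 q0.
rewrite sizes in leB eqB.
split=> [|eE]; first by lia.
have dE : degree G y = a - 1 by lia.
have eE' : #|edges G| = #|X| * (#|~: X| - 1) + degree G y by lia.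
have degX := degree_le bipX yX.
have := iso_Dgraph bipX yX eE'; rewrite dE => iso.
have {eqB} := eqB ltac:(lia); case: ifP => oddn => [qE|[qE|qE]].
- have -> : (#|V| + 1) %/ 2 - a = #|X| - (a - 1) by lia.
  by have -> : (#|V| - 1) %/ 2 = #|~: X| - 1 by lia.
- right; have -> : #|V| %/ 2 - 1 = #|~: X| - 1 by lia.
  by have -> : #|V| %/ 2 - a + 1 = #|X| - (a - 1) by lia.
left; have -> : #|V| %/ 2 - a = #|X| - (a - 1) by lia.
by have -> : #|V| %/ 2 = #|~: X| - 1 by lia.
Qed.

Hypothesis hab : 0 < a <= b.
Hypothesis n_gt0 : 0 < #|V|.

Lemma small_part_case : #|X| <= kab a b #|V| ->
  #|edges G| <= fab a b #|V| /\
  (#|edges G| = fab a b #|V| ->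
     graph_iso G (Kbip (kab a b #|V|) (#|V| - kab a b #|V|))).
Proof.
move=> Xk; have := fab_mono (p := #|X|) (q := #|~: X|) hab; rewrite sizes.
move=> /(_ n_gt0 Xk)[leXf eqXf]; have leX := card_edges_le.
split=> [|eE]; first exact: leq_trans leX leXf.
have kE : #|X| = kab a b #|V| by apply: eqXf; rewrite -eE.
have -> : #|V| - kab a b #|V| = #|~: X| by rewrite -kE -sizes addKn.
rewrite -kE; apply: iso_Kbip => //; apply/eqP.
by rewrite eqn_leq leX eE leXf.
Qed.

Lemma barrier_case : kab a b #|V| < #|X| -> kab a b #|V| < #|~: X| ->
  (forall v, a <= degree G v) -> barrier G X a b ->
  #|edges G| <= bal a #|V| /\
  (#|edges G| = bal a #|V| -> bal a #|V| < fab a b #|V|).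
Proof.
move=> kp kq mindeg [S [T [SX TX]]].
set c := \sum_(y in T) _ => lt_c.
have [y yT] : exists y, y \in T.
  by apply/card_gt0P; move: lt_c; case: #|T| => //; rewrite muln0.
have yX := subsetP TX y yT.
have q0 : 0 < #|~: X| by apply/card_gt0P; exists y.
have ap := leq_trans (mindeg y) (degree_le bipX yX).
have aqE : a * #|~: X| <= #|edges G|.
  rewrite (card_edges_degree bipX) mulnC -sum_nat_const.
  by apply: leq_sum => z _; apply: mindeg.
have tq := subset_leq_card TX.
have cardXS : #|X :\: S| = #|X| - #|S| by rewrite cardsD (setIidPr SX).
(* The non-edges between [T] and [X :\: S] are among all non-edges across the bipartition. *)
have eT : #|edges G| + #|T| * (#|X| - #|S|) <= #|X| * #|~: X| + c.
  rewrite -(card_edges_compl bipX) -addnA leq_add2l -cardXS -sum_nat_const.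
  have -> : \sum_(z in T) #|X :\: S| = c + \sum_(z in T) \sum_(x in X :\: S) ~~ G x z.
    rewrite -big_split /=; apply: eq_bigr => z _.
    rewrite -sum1_card -big_split /=; apply: eq_bigr => x _.
    by rewrite adj_sym; case: (G x z).
  rewrite addnC leq_add2r exchange_big /=.
  rewrite [X in _ <= X](big_setID S) /= (setIidPr SX).
  apply: leq_trans (leq_addl _ _); apply: leq_sum => x _.
  rewrite [X in _ <= X](big_setID T) /= (setIidPr TX); exact: leq_addr.
(* With [S] empty the barrier would bound the degree sum over [T] below [a * #|T|]. *)
have s0 : 0 < #|S|.
  rewrite lt0n cards_eq0; apply: contraTneq lt_c => S0.
  rewrite /c S0 cards0 muln0 add0n -leqNgt setD0 mulnC -sum_nat_const.
  apply: leq_sum => z zT; rewrite -(degree_part bipX) ?mindeg //.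
  exact: (subsetP TX).
have /andP[a0 ab] := hab; have b0 : 0 < b by lia.
have aqbp : a * #|~: X| <= b * #|X|.
  by have := kab_small a0 b0 n_gt0 kp; rewrite -sizes; lia.
(* With [S] equal to [X] the barrier would contradict [aqbp]. *)
have sp : #|S| < #|X|.
  have := subset_leq_card SX; rewrite leq_eqVlt => /orP[/eqP sE|//].
  have : a * #|T| <= a * #|~: X| by rewrite leq_mul2l tq orbT.
  by rewrite sE in lt_c; lia.
have [e1 e2] := barrier_bound hab ap aqbp (introT andP (conj s0 sp)) tq lt_c eT aqE.
by rewrite -sizes; apply: barrier_bal; rewrite ?sizes.
Qed.

End ExtremalCases.

(** * Combining the cases *)

(** The premise [fab a b #|V| <= bal a #|V|] is there because the barrier case excludes equality
    with [bal] only under it. *)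
Definition max_edge_dichotomy (V : finType) (G : sgraph V) a b :=
  (#|edges G| <= fab a b #|V| /\
   (#|edges G| = fab a b #|V| ->
      graph_iso G (Kbip (kab a b #|V|) (#|V| - kab a b #|V|)))) \/
  (#|edges G| <= bal a #|V| /\
   (#|edges G| = bal a #|V| -> fab a b #|V| <= bal a #|V| ->
    if odd #|V| then
      graph_iso G (Dgraph (a - 1) ((#|V| + 1) %/ 2 - a) ((#|V| - 1) %/ 2) 1)
    else graph_iso G (Dgraph (a - 1) (#|V| %/ 2 - a) (#|V| %/ 2) 1) \/
      graph_iso G (Dgraph (a - 1) (#|V| %/ 2 - a + 1) (#|V| %/ 2 - 1) 1))).

Lemma no_factor_dichotomy (V : finType) (G : sgraph V) a b : 0 < a <= b ->
  a <= #|V| %/ 2 -> bipartite G -> ~ has_factor a b G -> max_edge_dichotomy G a b.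
Proof.
move=> hab an [X bipX] nofac; have n0 : 0 < #|V| by lia.
have bipC x y : G x y -> (x \in ~: X) != (y \in ~: X).
  by move/bipX; rewrite !inE; case: (x \in X); case: (y \in X).
case: (leqP #|X| (kab a b #|V|)) => kp; first by left; apply: small_part_case bipX _ _ _.
case: (leqP #|~: X| (kab a b #|V|)) => kq; first by left; apply: small_part_case bipC _ _ _.
right; case: (boolP [forall v, a <= degree G v]) => [/forallP mindeg|/forallPn[y]].
  have bar : #|edges G| <= bal a #|V| /\
      (#|edges G| = bal a #|V| -> bal a #|V| < fab a b #|V|).
    have /andP[_ ab] := hab.
    case: (bipartite_factor_or_barrier bipX ab) => // hbar.
      exact: barrier_case bipX _ _ _ _ _ hbar.
    by apply: barrier_case bipC _ _ _ _ _ hbar => //; rewrite setCK.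
  by case: bar => leB ltf; split=> // /ltf; rewrite ltnNge => /negP.
rewrite -ltnNge => ya.
have low : exists Z : {set V},
    [/\ forall x z, G x z -> (x \in Z) != (z \in Z) & y \in ~: Z].
  by case: (boolP (y \in X)) => yX; [exists (~: X); rewrite setCK | exists X; rewrite inE].
have [Z [bipZ yZ]] := low; have [leB eqB] := low_degree_case bipZ an yZ ya.
by split=> // eE _; apply: eqB.
Qed.

Theorem theorem1p4 (a b n : nat) (V : finType) (G : sgraph V)
    (a_gt0 : 0 < a) (b_gt0 : 0 < b) (n_gt0 : 0 < n)
    (le_ab : a <= b) (le_an : a <= n %/ 2)
    (cardV : #|V| = n) (bipG : bipartite G) (nofactor : ~ has_factor a b G) :
  (fab a b n > n %/ 2 * (uphalf n - 1) + a - 1 ->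
     #|edges G| <= fab a b n /\
     (#|edges G| = fab a b n <->
        graph_iso G (Kbip (kab a b n) (n - kab a b n)))) /\
  (~~ odd n -> fab a b n = n %/ 2 * (n %/ 2 - 1) + a - 1 ->
     #|edges G| <= fab a b n /\
     (#|edges G| = fab a b n <->
        graph_iso G (Kbip (kab a b n) (n - kab a b n)) \/
        graph_iso G (Dgraph (a - 1) (n %/ 2 - a) (n %/ 2) 1) \/
        graph_iso G (Dgraph (a - 1) (n %/ 2 - a + 1) (n %/ 2 - 1) 1))) /\
  (odd n -> fab a b n = ((n - 1) %/ 2) ^ 2 + a - 1 ->
     #|edges G| <= fab a b n /\
     (#|edges G| = fab a b n <->
        graph_iso G (Kbip (kab a b n) (n - kab a b n)) \/
        graph_iso G (Dgraph (a - 1) ((n + 1) %/ 2 - a) ((n - 1) %/ 2) 1))) /\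
  (~~ odd n -> fab a b n < n %/ 2 * (n %/ 2 - 1) + a - 1 ->
     #|edges G| <= n %/ 2 * (n %/ 2 - 1) + a - 1 /\
     (#|edges G| = n %/ 2 * (n %/ 2 - 1) + a - 1 <->
        graph_iso G (Dgraph (a - 1) (n %/ 2 - a) (n %/ 2) 1) \/
        graph_iso G (Dgraph (a - 1) (n %/ 2 - a + 1) (n %/ 2 - 1) 1))) /\
  (odd n -> fab a b n < ((n - 1) %/ 2) ^ 2 + a - 1 ->
     #|edges G| <= ((n - 1) %/ 2) ^ 2 + a - 1 /\
     (#|edges G| = ((n - 1) %/ 2) ^ 2 + a - 1 <->
        graph_iso G (Dgraph (a - 1) ((n + 1) %/ 2 - a) ((n - 1) %/ 2) 1))).
Proof.
have hab : 0 < a <= b by rewrite a_gt0 le_ab.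
have dich : max_edge_dichotomy G a b by apply: no_factor_dichotomy; rewrite ?cardV.
rewrite /max_edge_dichotomy cardV in dich.
(* The converse directions hold because isomorphic graphs have equally many edges. *)
have isoK : graph_iso G (Kbip (kab a b n) (n - kab a b n)) -> #|edges G| = fab a b n.
  by move/iso_card_edges ->; rewrite card_edges_Kbip.
have bal_evenEven : ~~ odd n -> bal a n = n %/ 2 * (n %/ 2 - 1) + a - 1.
  by move=> ev; apply: bal_evenE; lia.
have balOdd : odd n -> bal a n = ((n - 1) %/ 2) ^ 2 + a - 1.
  by move=> od; rewrite -mulnn; apply: bal_oddE; lia.
have isoD1 : ~~ odd n -> graph_iso G (Dgraph (a - 1) (n %/ 2 - a) (n %/ 2) 1) ->
    #|edges G| = bal a n.
  move=> ev /iso_card_edges ->; rewrite card_edges_Dgraph bal_evenEven //.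
  have [d dE] : exists d, n %/ 2 = a + d by exists (n %/ 2 - a); lia.
  by rewrite dE addKn; case: (a) a_gt0 => // a' _; rewrite addSn !subn1 /=; lia.
have isoD2 : ~~ odd n ->
    graph_iso G (Dgraph (a - 1) (n %/ 2 - a + 1) (n %/ 2 - 1) 1) ->
    #|edges G| = bal a n.
  move=> ev /iso_card_edges ->; rewrite card_edges_Dgraph bal_evenEven //.
  have [d dE] : exists d, n %/ 2 = a + d by exists (n %/ 2 - a); lia.
  by rewrite dE addKn; case: (a) a_gt0 => // a' _; rewrite addSn !subn1 /=; lia.
have isoD3 : odd n ->
    graph_iso G (Dgraph (a - 1) ((n + 1) %/ 2 - a) ((n - 1) %/ 2) 1) ->
    #|edges G| = bal a n.
  move=> od /iso_card_edges ->; rewrite card_edges_Dgraph balOdd // -mulnn.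
  have -> : (n + 1) %/ 2 = ((n - 1) %/ 2).+1 by lia.
  have [d dE] : exists d, (n - 1) %/ 2 = a + d by exists ((n - 1) %/ 2 - a); lia.
  rewrite dE -addnS addKn; case: (a) a_gt0 => // a' _; rewrite addSn !subn1 /=; lia.
split; last split; last split; last split.
(* When one bound is strictly smaller, the alternative giving it cannot attain the larger one. *)
- rewrite -/(bal a n) => ltf; case: dich => [[leE eqE]|[leE _]].
    by split=> //; split.
  split; first by lia.
  by split=> // eE; lia.
- move=> ev; rewrite -bal_evenEven // => fE; case: dich => [[leE eqE]|].
    split=> //; split=> [/eqE|[/isoK|[/(isoD1 ev)|/(isoD2 ev)]]]; rewrite ?fE //.
    by left.
  rewrite (negbTE ev) fE => -[leE eqE]; split=> //; split=> [eE|].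
    by right; apply: eqE.
  by case=> [/isoK|[/(isoD1 ev)|/(isoD2 ev)]]; rewrite ?fE.
- move=> od; rewrite -balOdd // => fE; case: dich => [[leE eqE]|].
    split=> //; split=> [/eqE|[/isoK|/(isoD3 od)]]; rewrite ?fE //.
    by left.
  rewrite od fE => -[leE eqE]; split=> //; split=> [eE|].
    by right; apply: eqE.
  by case=> [/isoK|/(isoD3 od)]; rewrite ?fE.
- move=> ev; rewrite -bal_evenEven // => fE; case: dich => [[leE _]|].
    split; first by lia.
    by split=> [|[/(isoD1 ev)|/(isoD2 ev)]] //; lia.
  rewrite (negbTE ev) => -[leE eqE]; split=> //; split=> [eE|[/(isoD1 ev)|/(isoD2 ev)]] //.
  by apply: eqE => //; apply: ltnW.
move=> od; rewrite -balOdd // => fE; case: dich => [[leE _]|].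
  split; first by lia.
  by split=> [|/(isoD3 od)] //; lia.
rewrite od => -[leE eqE]; split=> //; split=> [eE|/(isoD3 od)] //.
by apply: eqE => //; apply: ltnW.
Qed.
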